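(* Let $p$ be a prime and let $R=\mathbb{Z}_p[[x]][[y;\delta]]$, where $\delta$ is the $\mathbb{Z}_p$-linear derivation of $\mathbb{Z}_p[[x]]$ with $\delta(x)=p^2$ (so $yx-xy=p^2$ in $R$). Then the unique prime ideal of $R$ of height $1$ is $pR$. In particular, $R$ is a noncommutative unique factorisation domain in the sense of Chatters–Jordan.
   Context: $R$ is the ring of formal power series $\sum_{j\ge0}b_jy^j$, $b_j\in\mathbb{Z}_p[[x]]$, with the continuous multiplication (for the topology given by powers of the ideal generated by $p,x,y$) extending $yb=by+\delta(b)$ for $b\in\mathbb{Z}_p[[x]]$; it is a complete local ring. Here $\delta=p^2\,d/dx$. Prime ideals are two-sided; a prime ideal has height $1$ if it is nonzero and minimal among nonzero prime ideals ($R$ is a domain). In the sense of Chatters–Jordan, an element $q$ of a Noetherian domain $R$ is completely prime if $q\neq0$, $qR=Rq$, and $R/qR$ is a domain; a (noncommutative, Noetherian) unique factorisation domain is a Noetherian domain in which every nonzero prime ideal contains a completely prime element. *)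

(* Defs.v *)
From HB Require Import structures.
From mathcomp Require Import all_boot all_order all_algebra.
From mathcomp Require Import boolp classical_sets.
From mathcomp Require Import zify.

Set Implicit Arguments.
Unset Strict Implicit.
Unset Printing Implicit Defensive.

Import GRing.Theory Num.Theory.

Local Open Scope classical_set_scope.
Local Open Scope ring_scope.

(* Rings are not assumed commutative, nor (pzRingType) nontrivial.            *)
Section RingNotions.

Variable R : pzRingType.
Implicit Types (I J P Q : set R) (q : R).

Definition left_ideal I :=
  [/\ I 0, forall a b, I a -> I b -> I (a + b) & forall r a, I a -> I (r * a)].

Definition right_ideal I :=
  [/\ I 0, forall a b, I a -> I b -> I (a + b) & forall r a, I a -> I (a * r)].

Definition two_sided_ideal I := left_ideal I /\ right_ideal I.

Definition prime_ideal P :=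
  [/\ two_sided_ideal P, P <> [set: R] &
      forall I J, two_sided_ideal I -> two_sided_ideal J ->
        (forall a b, I a -> J b -> P (a * b)) -> I `<=` P \/ J `<=` P].

(* Height one in a domain: nonzero, and minimal among nonzero primes.         *)
Definition height1_prime P :=
  [/\ prime_ideal P, P <> [set 0] &
      forall Q, prime_ideal Q -> Q <> [set 0] -> Q `<=` P -> Q = P].

Definition ascending (I : nat -> set R) := forall n, I n `<=` I n.+1.

Definition stationary (I : nat -> set R) :=
  exists n, forall m, (n <= m)%N -> I m = I n.

Definition left_noetherian :=
  forall I : nat -> set R,
    (forall n, left_ideal (I n)) -> ascending I -> stationary I.

Definition right_noetherian :=
  forall I : nat -> set R,
    (forall n, right_ideal (I n)) -> ascending I -> stationary I.

Definition noetherian := left_noetherian /\ right_noetherian.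

Definition domain :=
  1 <> 0 :> R /\ forall a b : R, a * b = 0 -> a = 0 \/ b = 0.

Definition principal_right q : set R := [set q * r | r in [set: R]].
Definition principal_left q : set R := [set r * q | r in [set: R]].

(* The quotient R / I is a domain, written on representatives.                *)
Definition quotient_domain I :=
  ~ I 1 /\ forall a b, I (a * b) -> I a \/ I b.

Definition completely_prime q :=
  [/\ q <> 0, principal_right q = principal_left q &
      quotient_domain (principal_right q)].

Definition chatters_jordan_UFD :=
  [/\ noetherian, domain &
      forall P, prime_ideal P -> P <> [set 0] ->
        exists2 q, P q & completely_prime q].

Definition noncommutative := exists a b : R, a * b <> b * a.

End RingNotions.

(* The p-adic integers, as the inverse limit of the rings Z / p^n Z, whose    *)
(* elements are represented by their least nonnegative residues.              *)
Record padic (p : nat) := Padic {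
  residue :> nat -> int;
  residueP : forall n, residue n = (residue n.+1 %% (p ^ n)%:Z)%Z
}.

HB.instance Definition _ (p : nat) := gen_eqMixin (padic p).
HB.instance Definition _ (p : nat) := gen_choiceMixin (padic p).

Section PadicRing.

Variable p : nat.
Implicit Types (a b c : padic p) (n : nat).

Lemma padicP a b : (forall n, a n = b n) <-> a = b.
Proof.
split=> [|-> //]; case: a b => [u uP] [v vP] /= /funext uv.
by move: uP; rewrite uv => uP; congr Padic; exact: Prop_irrelevance.
Qed.

Lemma residue_mod a n : (a n %% (p ^ n)%:Z)%Z = a n.
Proof. by rewrite residueP modz_mod. Qed.

Lemma modz_expS (x : int) n :
  ((x %% (p ^ n.+1)%:Z)%Z %% (p ^ n)%:Z)%Z = (x %% (p ^ n)%:Z)%Z.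
Proof.
rewrite [x in RHS](divz_eq x (p ^ n.+1)%:Z) expnS PoszM mulrA.
by rewrite modzMDl.
Qed.

Fact padic_of_subproof (u : nat -> int) :
  (forall n, (u n.+1 %% (p ^ n)%:Z)%Z = (u n %% (p ^ n)%:Z)%Z) ->
  forall n, (u n %% (p ^ n)%:Z)%Z =
            ((u n.+1 %% (p ^ n.+1)%:Z)%Z %% (p ^ n)%:Z)%Z.
Proof. by move=> uP n; rewrite modz_expS uP. Qed.

Definition padic_of (u : nat -> int)
    (uP : forall n, (u n.+1 %% (p ^ n)%:Z)%Z = (u n %% (p ^ n)%:Z)%Z) :
    padic p :=
  Padic (padic_of_subproof uP).

Fact padic_int_subproof (x : int) n :
  (x %% (p ^ n)%:Z)%Z = (x %% (p ^ n)%:Z)%Z.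
Proof. by []. Qed.

Definition padic_int (x : int) : padic p := padic_of (padic_int_subproof x).

Fact padic_opp_subproof a n :
  ((- a n.+1) %% (p ^ n)%:Z)%Z = ((- a n) %% (p ^ n)%:Z)%Z.
Proof. by rewrite [a n]residueP modzNm. Qed.

Definition padic_opp a : padic p := padic_of (padic_opp_subproof a).

Fact padic_add_subproof a b n :
  ((a n.+1 + b n.+1) %% (p ^ n)%:Z)%Z = ((a n + b n) %% (p ^ n)%:Z)%Z.
Proof. by rewrite [a n]residueP [b n]residueP modzDm. Qed.

Definition padic_add a b : padic p := padic_of (padic_add_subproof a b).

Fact padic_mul_subproof a b n :
  ((a n.+1 * b n.+1) %% (p ^ n)%:Z)%Z = ((a n * b n) %% (p ^ n)%:Z)%Z.
Proof. by rewrite [a n]residueP [b n]residueP modzMm. Qed.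

Definition padic_mul a b : padic p := padic_of (padic_mul_subproof a b).

Fact padic_addA : associative padic_add.
Proof.
by move=> a b c; apply/padicP=> n /=; rewrite modzDml modzDmr addrA.
Qed.

Fact padic_addC : commutative padic_add.
Proof. by move=> a b; apply/padicP=> n /=; rewrite addrC. Qed.

Fact padic_add0 : left_id (padic_int 0) padic_add.
Proof.
by move=> a; apply/padicP=> n /=; rewrite mod0z add0r residue_mod.
Qed.

Fact padic_addN : left_inverse (padic_int 0) padic_opp padic_add.
Proof. by move=> a; apply/padicP=> n /=; rewrite modzDml addNr. Qed.

HB.instance Definition _ := GRing.isZmodule.Build (padic p)
  padic_addA padic_addC padic_add0 padic_addN.

Fact padic_mulA : associative padic_mul.
Proof.
by move=> a b c; apply/padicP=> n /=; rewrite modzMml modzMmr mulrA.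
Qed.

Fact padic_mulC : commutative padic_mul.
Proof. by move=> a b; apply/padicP=> n /=; rewrite mulrC. Qed.

Fact padic_mul1 : left_id (padic_int 1) padic_mul.
Proof.
by move=> a; apply/padicP=> n /=; rewrite modzMml mul1r residue_mod.
Qed.

Fact padic_mulDl : left_distributive padic_mul +%R.
Proof.
by move=> a b c; apply/padicP=> n /=; rewrite modzMml modzDm mulrDl.
Qed.

HB.instance Definition _ := GRing.Zmodule_isComPzRing.Build (padic p)
  padic_mulA padic_mulC padic_mul1 padic_mulDl.

Lemma residue0 n : (0 : padic p) n = 0.
Proof. exact: mod0z. Qed.

Lemma residueD a b n : (a + b) n = ((a n + b n) %% (p ^ n)%:Z)%Z.
Proof. by []. Qed.

Lemma residueM a b n : (a * b) n = ((a n * b n) %% (p ^ n)%:Z)%Z.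
Proof. by []. Qed.

Lemma residue_level0 a : a 0%N = 0.
Proof. by rewrite -residue_mod expn0 modz1. Qed.

End PadicRing.

Arguments residue : simpl never.

(* p-adic limit: u m is eventually equal to l modulo each p^n. Junk value 0   *)
(* when u does not converge.                                                  *)
Definition padic_lim (p : nat) (u : nat -> padic p) : padic p :=
  xget 0 [set l : padic p | forall n, exists m0,
            forall m, (m0 <= m)%N -> u m n = l n].

(* fps A is A[[x]]; f n is the coefficient of x^n.                            *)
Definition fps (A : Type) := nat -> A.

HB.instance Definition _ (A : Type) := gen_eqMixin (fps A).
HB.instance Definition _ (A : Type) := gen_choiceMixin (fps A).

Section FpsZmod.

Variable A : zmodType.
Implicit Types (f g h : fps A) (n : nat).

Definition fps_zero : fps A := fun=> 0.
Definition fps_opp f : fps A := fun n => - f n.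
Definition fps_add f g : fps A := fun n => f n + g n.

Fact fps_addA : associative fps_add.
Proof. by move=> f g h; apply/funext=> n; exact: addrA. Qed.

Fact fps_addC : commutative fps_add.
Proof. by move=> f g; apply/funext=> n; exact: addrC. Qed.

Fact fps_add0 : left_id fps_zero fps_add.
Proof. by move=> f; apply/funext=> n; exact: add0r. Qed.

Fact fps_addN : left_inverse fps_zero fps_opp fps_add.
Proof. by move=> f; apply/funext=> n; exact: addNr. Qed.

HB.instance Definition _ := GRing.isZmodule.Build (fps A)
  fps_addA fps_addC fps_add0 fps_addN.

Lemma fps0E n : (0 : fps A) n = 0. Proof. by []. Qed.

Lemma fpsDE f g n : (f + g) n = f n + g n. Proof. by []. Qed.

Lemma fpsMnE f k n : (f *+ k) n = f n *+ k.
Proof. by elim: k => // k IHk; rewrite !mulrS fpsDE IHk. Qed.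

Lemma fps_sumE (I : Type) (r : seq I) (P : pred I) (F : I -> fps A) n :
  (\sum_(i <- r | P i) F i) n = \sum_(i <- r | P i) F i n.
Proof. by elim/big_rec2: _ => // i y z _ <-. Qed.

Definition fps_deriv f : fps A := fun n => f n.+1 *+ n.+1.

End FpsZmod.

Section FpsRing.

Variable A : comPzRingType.
Implicit Types (f g h : fps A) (n : nat).

Definition fps_const (a : A) : fps A := fun n => if n == 0%N then a else 0.

Definition fps_X : fps A := fun n => (n == 1%N)%:R.

Definition fps_mul f g : fps A := fun n => \sum_(i < n.+1) f i * g (n - i)%N.

Fact fps_mulC : commutative fps_mul.
Proof.
move=> f g; apply/funext=> n; rewrite /fps_mul (reindex_inj rev_ord_inj) /=.
by apply: eq_bigr => i _; rewrite subSS (sub_ordK i) mulrC.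
Qed.

Fact fps_mul_rev f g n : fps_mul f g n = \sum_(i < n.+1) f (n - i)%N * g i.
Proof.
rewrite fps_mulC; apply: eq_bigr => i _; exact: mulrC.
Qed.

Fact fps_mulA : associative fps_mul.
Proof.
move=> f g h; apply/funext=> i; rewrite {1}/fps_mul fps_mul_rev.
pose coef3 j k := f j * (g (i - j - k)%N * h k).
transitivity (\sum_(j < i.+1) \sum_(k < i.+1 | (k <= i - j)%N) coef3 j k).
  apply: eq_bigr => /= j _; rewrite fps_mul_rev big_distrr /=.
  by rewrite (big_ord_narrow_leq (leq_subr _ _)).
rewrite (exchange_big_dep predT) //=; apply: eq_bigr => k _.
transitivity (\sum_(j < i.+1 | (j <= i - k)%N) coef3 j k).
  apply: eq_bigl => j; rewrite -ltnS -(ltnS j) -!subSn ?leq_ord //.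
  by rewrite -subn_gt0 -(subn_gt0 j) -!subnDA addnC.
rewrite (big_ord_narrow_leq (leq_subr _ _)) /fps_mul big_distrl /=.
by apply: eq_bigr => j _; rewrite /coef3 -!subnDA addnC mulrA.
Qed.

Fact fps_mul_const (a : A) f n : fps_mul (fps_const a) f n = a * f n.
Proof.
rewrite /fps_mul big_ord_recl subn0 big1 ?addr0 // => i _.
by rewrite /fps_const /= mul0r.
Qed.

Fact fps_mul1 : left_id (fps_const 1) fps_mul.
Proof. by move=> f; apply/funext=> n; rewrite fps_mul_const mul1r. Qed.

Fact fps_mulDl : left_distributive fps_mul +%R.
Proof.
move=> f g h; apply/funext=> n; rewrite fpsDE /fps_mul -big_split /=.
by apply: eq_bigr => i _; rewrite fpsDE mulrDl.
Qed.

HB.instance Definition _ := GRing.Zmodule_isComPzRing.Build (fps A)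
  fps_mulA fps_mulC fps_mul1 fps_mulDl.

Lemma fpsME f g n : (f * g) n = \sum_(i < n.+1) f i * g (n - i)%N.
Proof. by []. Qed.

Lemma fps_derivD f g : fps_deriv (f + g) = fps_deriv f + fps_deriv g.
Proof. by apply/funext=> n; rewrite fpsDE /fps_deriv fpsDE mulrnDl. Qed.

Lemma fps_derivM f g :
  fps_deriv (f * g) = fps_deriv f * g + f * fps_deriv g.
Proof.
apply/funext=> n; rewrite /fps_deriv fpsDE !fpsME.
transitivity (\sum_(i < n.+2) (f i *+ i * g (n.+1 - i)%N
                + f i * (g (n.+1 - i)%N *+ (n.+1 - i)))).
  rewrite -sumrMnl; apply: eq_bigr => i _.
  by rewrite mulrnAl mulrnAr -mulrnDr subnKC // -ltnS.
rewrite big_split /=; congr (_ + _).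
  rewrite big_ord_recl mulr0n mul0r add0r.
  by apply: eq_bigr => i _; rewrite lift0 subSS.
rewrite big_ord_recr /= subnn mulr0n mulr0 addr0.
by apply: eq_bigr => i _; rewrite subSn // -ltnS.
Qed.

End FpsRing.

(* The ring Z_p[[x]][[y; delta]], delta = p^2 d/dx. An element f stands for   *)
(* sum_j f_j y^j, with coefficients f_j = f j in Z_p[[x]] on the left.        *)
Definition skewfps (p : nat) := nat -> fps (padic p).

HB.instance Definition _ (p : nat) :=
  GRing.Zmodule.copy (skewfps p) (fps (fps (padic p))).

Definition skew_const (p : nat) (b : fps (padic p)) : skewfps p :=
  fun n => if n == 0%N then b else 0.

Definition skew_y (p : nat) : skewfps p := fun n => (n == 1%N)%:R.

Definition delta (p : nat) (b : fps (padic p)) : fps (padic p) :=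
  fps_deriv b *+ p ^ 2.

(* Left multiplication by y, as forced by y b = b y + delta b:                *)
(*   y (sum_j b_j y^j) = sum_j (b_j y^(j+1) + (delta b_j) y^j).               *)
Definition mul_y (p : nat) (f : skewfps p) : skewfps p :=
  fun n => (if n is m.+1 then f m else 0) + delta (f n).

(* (sum_i f_i y^i) g = sum_i f_i (y^i g). Each coefficient of this infinite   *)
(* sum converges p-adically since delta is divisible by p^2: see skew_mul_cvg *)
(* below. Convergence of all the coefficients is convergence in the topology  *)
(* given by the powers of the ideal (p, x, y).                                *)
Definition skew_mul (p : nat) (f g : skewfps p) : skewfps p :=
  fun j i => padic_lim
    (fun m => (\sum_(k < m) f k * iter k (@mul_y p) g j) i).

Section SkewRing.

Variable p : nat.
Local Notation B := (fps (padic p)).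
Implicit Types (a b c d : B) (f g h : skewfps p) (i j k m n N : nat).

Lemma skewDE f g n : (f + g) n = f n + g n. Proof. by []. Qed.

Lemma deltaD b c : delta (b + c) = delta b + delta c.
Proof. by rewrite /delta fps_derivD mulrnDl. Qed.

Lemma deltaM b c : delta (b * c) = delta b * c + b * delta c.
Proof. by rewrite /delta fps_derivM mulrnDl mulrnAl mulrnAr. Qed.

Lemma delta0 : delta (0 : B) = 0.
Proof. by apply: (addrI (delta 0)); rewrite -deltaD !addr0. Qed.

Lemma delta_sum m (F : 'I_m -> B) :
  delta (\sum_(k < m) F k) = \sum_(k < m) delta (F k).
Proof. exact: (big_morph _ deltaD delta0). Qed.

Lemma delta_X : delta (fps_X (padic p)) = (p ^ 2)%:R.
Proof.
rewrite /delta; congr (_ *+ _); apply/funext => -[|n] //.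
by rewrite /fps_deriv /fps_X /= mul0rn.
Qed.

Definition eqmod N b c := forall i, b i N = c i N.

Lemma eqmod_refl N b : eqmod N b b. Proof. by []. Qed.

Lemma eqmod_sym N b c : eqmod N b c -> eqmod N c b.
Proof. by move=> bc i; rewrite bc. Qed.

Lemma eqmod_trans N c b d : eqmod N b c -> eqmod N c d -> eqmod N b d.
Proof. by move=> bc cd i; rewrite bc. Qed.

Lemma eqmodD N b c b' c' :
  eqmod N b b' -> eqmod N c c' -> eqmod N (b + c) (b' + c').
Proof. by move=> bb' cc' i; rewrite !fpsDE !residueD bb' cc'. Qed.

Lemma eqmod_sum N m (F G : 'I_m -> B) :
  (forall k : 'I_m, eqmod N (F k) (G k)) ->
  eqmod N (\sum_(k < m) F k) (\sum_(k < m) G k).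
Proof.
move=> FG; elim/big_rec2: _ => [|k b c _]; first exact: eqmod_refl.
exact: eqmodD (FG k).
Qed.

Lemma eqmodMn N b b' k : eqmod N b b' -> eqmod N (b *+ k) (b' *+ k).
Proof. by move=> bb'; elim: k => // k IHk; rewrite !mulrS; exact: eqmodD. Qed.

Lemma padic_sum_mod N m (u v : nat -> padic p) :
  (forall k, u k N = v k N) ->
  (\sum_(k < m) u k) N = (\sum_(k < m) v k) N.
Proof.
move=> uv; elim: m => [|m IHm]; first by rewrite !big_ord0.
by rewrite !big_ord_recr /= !residueD IHm uv.
Qed.

Lemma eqmodM N b c b' c' :
  eqmod N b b' -> eqmod N c c' -> eqmod N (b * c) (b' * c').
Proof.
move=> bb' cc' i; rewrite !fpsME.
apply: (@padic_sum_mod N i.+1 (fun k => b k * c (i - k)%N)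
  (fun k => b' k * c' (i - k)%N)) => k.
by rewrite !residueM bb' cc'.
Qed.

Lemma eqmod_delta N b b' : eqmod N b b' -> eqmod N (delta b) (delta b').
Proof.
move=> bb'; apply: eqmodMn => i; rewrite /fps_deriv.
have := @eqmodMn N (fun=> b i.+1) (fun=> b' i.+1) i.+1 (fun=> bb' i.+1) 0%N.
by rewrite !fpsMnE.
Qed.

Lemma eqmodP f g : (forall N j, eqmod N (f j) (g j)) -> f = g.
Proof.
move=> fg; apply/funext=> j; apply/funext=> i.
by apply/padicP => N; exact: fg.
Qed.

Lemma residueMn (x : padic p) k N :
  (x *+ k) N = ((x N * k%:Z) %% (p ^ N)%:Z)%Z.
Proof.
elim: k => [|k IHk]; first by rewrite mulr0n residue0 mulr0 mod0z.
by rewrite mulrS residueD IHk modzDmr intS mulrDr mulr1.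
Qed.

Lemma residueMp (x : padic p) N : x N = 0 -> (x *+ p) N.+1 = 0.
Proof.
rewrite residueMn residueP => xN0; rewrite (divz_eq (x N.+1) (p ^ N)%:Z) xN0.
by rewrite addr0 -mulrA -PoszM -expnSr modzMl.
Qed.

Lemma eqmod_delta0 N b : eqmod N b 0 -> eqmod N.+1 (delta b) 0.
Proof.
move=> b0 i; rewrite /delta fpsMnE -mulnn mulrnA residue0; apply: residueMp.
rewrite /fps_deriv !residueMn b0 fps0E residue0.
by rewrite mul0r mod0z mul0r mod0z.
Qed.

Lemma mul_y0 f : mul_y f 0%N = delta (f 0%N).
Proof. by rewrite /mul_y add0r. Qed.

Lemma mul_yS f n : mul_y f n.+1 = f n + delta (f n.+1).
Proof. by []. Qed.

Lemma mul_yD f g : mul_y (f + g) = mul_y f + mul_y g.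
Proof.
apply/funext => -[|n]; rewrite skewDE ?mul_y0 ?mul_yS !skewDE deltaD //.
by rewrite addrACA.
Qed.

Lemma iter_mul_yD k f g :
  iter k (@mul_y p) (f + g) = iter k (@mul_y p) f + iter k (@mul_y p) g.
Proof. by elim: k => //= k ->; rewrite mul_yD. Qed.

Lemma iter_mul_y_small N n k f :
  (n + N <= k)%N -> eqmod N (iter k (@mul_y p) f n) 0.
Proof.
elim: k n N => [|k IHk] n [|N] nNk; do ?by move=> i; rewrite !residue_level0.
  by rewrite addnS in nNk.
rewrite iterS -[0]addr0 /mul_y; apply: eqmodD.
  by case: n nNk => // n nNk; apply: IHk; rewrite addSn in nNk.
by apply/eqmod_delta0/IHk; rewrite addnS in nNk.
Qed.

Lemma padic_lim_cvg (u : nat -> padic p) (M : nat -> nat) :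
    (forall N m, (M N <= m)%N -> u m N = u (M N) N) ->
  forall N m, (M N <= m)%N -> padic_lim u N = u m N.
Proof.
move=> uM; pose v N := u (M N) N.
have vP N : v N = (v N.+1 %% (p ^ N)%:Z)%Z.
  rewrite /v -(uM N _ (leq_maxl _ (M N.+1))) residueP.
  by rewrite (uM N.+1 _ (leq_maxr (M N) _)).
pose P := [set l : padic p | forall n, exists m0,
  forall m, (m0 <= m)%N -> u m n = l n].
have Pv : P (Padic vP) by move=> n; exists (M n) => m /uM.
move=> N m MNm; rewrite (uM _ _ MNm).
have [m0 /(_ _ (leq_maxr (M N) m0)) <-] := xgetI 0 Pv N.
by apply: uM; exact: leq_maxl.
Qed.

Lemma skew_mul_cvg f g N j m : (j + N <= m)%N ->
  eqmod N (skew_mul f g j) (\sum_(k < m) f k * iter k (@mul_y p) g j).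
Proof.
move=> jNm i; apply: (padic_lim_cvg (M := fun N => (j + N)%N)) jNm => {m}N m.
elim: m => [|m IHm]; first by rewrite leqn0 => /eqP->.
rewrite leq_eqVlt => /predU1P[<-//|jNm]; rewrite -(IHm jNm).
rewrite big_ord_recr /=; set s := \sum_(k < m) _; set t := _ * _.
suff /(eqmodD (eqmod_refl N s)) : eqmod N t 0 by rewrite addr0; exact.
rewrite -(mulr0 (f m)); apply: eqmodM => //.
exact: iter_mul_y_small.
Qed.

Fact skew_mulDl : left_distributive (@skew_mul p) +%R.
Proof.
move=> f g h; apply: eqmodP => N j.
apply: eqmod_trans (skew_mul_cvg _ _ (leqnn _)) _; apply: eqmod_sym.
rewrite skewDE; apply: eqmod_trans (eqmodD (skew_mul_cvg _ _ (leqnn _))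
  (skew_mul_cvg _ _ (leqnn _))) _.
rewrite -big_split /=; apply: eqmod_sum => k.
by rewrite -mulrDl; exact: eqmod_refl.
Qed.

Fact skew_mulDr : right_distributive (@skew_mul p) +%R.
Proof.
move=> f g h; apply: eqmodP => N j.
apply: eqmod_trans (skew_mul_cvg _ _ (leqnn _)) _; apply: eqmod_sym.
rewrite skewDE; apply: eqmod_trans (eqmodD (skew_mul_cvg _ _ (leqnn _))
  (skew_mul_cvg _ _ (leqnn _))) _.
rewrite -big_split /=; apply: eqmod_sum => k.
by rewrite -mulrDr iter_mul_yD; exact: eqmod_refl.
Qed.

Lemma skew_mul_constl b g j : skew_mul (skew_const b) g j = b * g j.
Proof.
suff -> : skew_mul (skew_const b) g = (fun j => b * g j : B) by [].
apply: eqmodP => N {}j.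
apply: eqmod_trans (skew_mul_cvg _ _ (leqnSn _)) _.
rewrite big_ord_recl big1 ?addr0 => [|k _]; first exact: eqmod_refl.
by rewrite /skew_const /= mul0r.
Qed.

Fact skew_mul1 : left_id (skew_const 1) (@skew_mul p).
Proof. by move=> f; apply/funext=> j; rewrite skew_mul_constl mul1r. Qed.

Lemma delta1 : delta (1 : B) = 0.
Proof.
apply: (addrI (delta 1)).
by rewrite addr0 -[in RHS](mulr1 1) deltaM mulr1 mul1r.
Qed.

Lemma delta_nat n : delta (n%:R : B) = 0.
Proof.
by elim: n => [|n IHn]; rewrite ?delta0 // mulrS deltaD delta1 IHn addr0.
Qed.

Lemma iter_mul_y1 k j : iter k (@mul_y p) (skew_const 1) j = (j == k)%:R.
Proof.
elim: k j => [|k IHk] [|j] //; rewrite iterS ?mul_y0 ?mul_yS !IHk delta_nat //.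
by rewrite addr0.
Qed.

Fact skew_mulr1 : right_id (skew_const 1) (@skew_mul p).
Proof.
move=> f; apply: eqmodP => N j.
apply: eqmod_trans (skew_mul_cvg _ _ (leqnSn _)) _.
have jm : (j < (j + N).+1)%N by rewrite ltnS leq_addr.
rewrite (bigD1 (Ordinal jm)) //= iter_mul_y1 eqxx mulr1 big1 ?addr0 => [|k].
  exact: eqmod_refl.
by rewrite iter_mul_y1 -val_eqE /= eq_sym => /negPf->; rewrite mulr0.
Qed.

Lemma mul_yM g h : mul_y (skew_mul g h) = skew_mul (mul_y g) h.
Proof.
apply: eqmodP => N n; set Z := fun k => iter k (@mul_y p) h.
have cvg j m : (j + N <= m)%N ->
  eqmod N (skew_mul g h j) (\sum_(k < m) g k * Z k j) by exact: skew_mul_cvg.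
pose m := (n + N)%N.
apply: (@eqmod_trans _ (\sum_(k < m) (g k * Z k.+1 n + delta (g k) * Z k n))).
  case: n @m => [|n] m.
    rewrite mul_y0; apply: eqmod_trans (eqmod_delta (cvg _ m (leqnn _))) _.
    rewrite delta_sum; apply: eqmod_sum => k.
    by rewrite deltaM addrC /Z /= mul_y0; exact: eqmod_refl.
  rewrite mul_yS; apply: eqmod_trans (eqmodD (cvg _ m (leqnSn _))
     (eqmod_delta (cvg _ m (leqnn _)))) _.
  rewrite delta_sum -big_split /=; apply: eqmod_sum => k.
  rewrite deltaM mul_yS mulrDr [delta _ * _ + _]addrC addrA.
  exact: eqmod_refl.
apply: eqmod_sym; apply: eqmod_trans (skew_mul_cvg _ _ (leqnSn _)) _.
rewrite -/m -/Z big_split /=.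
under eq_bigr do rewrite mulrDl.
rewrite big_split /= big_ord_recl /= mul0r add0r.
apply: eqmodD; first exact: eqmod_refl.
rewrite big_ord_recr /= -[X in eqmod N _ X]addr0.
apply: eqmodD; first exact: eqmod_refl.
rewrite -(mulr0 (delta (g m))); apply: eqmodM => //.
exact: iter_mul_y_small.
Qed.

Lemma iter_mul_yM k g h :
  iter k (@mul_y p) (skew_mul g h) = skew_mul (iter k (@mul_y p) g) h.
Proof. by elim: k => //= k ->; rewrite mul_yM. Qed.

Fact skew_mulA : associative (@skew_mul p).
Proof.
move=> f g h; apply: eqmodP => N n; pose m := (n + N)%N.
apply: eqmod_trans (skew_mul_cvg _ _ (leq_addr N m)) _; apply: eqmod_sym.
apply: eqmod_trans (skew_mul_cvg _ _ (leqnn _)) _; rewrite -/m.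
set Z := fun k => iter k (@mul_y p).
apply: (@eqmod_trans _
  (\sum_(j < m) (\sum_(k < m + N) f k * Z k g j) * Z j h n)).
  apply: eqmod_sum => j; apply: eqmodM => //; apply: skew_mul_cvg.
  by rewrite leq_add2r ltnW.
under eq_bigr do rewrite big_distrl /=.
rewrite exchange_big /=; apply: eqmod_sum => k.
under eq_bigr do rewrite -mulrA.
rewrite -big_distrr /=; apply: eqmodM => //; apply: eqmod_sym.
rewrite iter_mul_yM; exact: skew_mul_cvg.
Qed.

HB.instance Definition _ := GRing.Zmodule_isPzRing.Build (skewfps p)
  skew_mulA skew_mul1 skew_mulr1 skew_mulDl skew_mulDr.

Lemma skew_constM b c : skew_const b * skew_const c = skew_const (b * c).
Proof.
apply/funext => -[|j]; rewrite [LHS]skew_mul_constl /skew_const //=.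
by rewrite mulr0.
Qed.

Lemma skew_yM f : skew_y p * f = mul_y f.
Proof.
have -> : skew_y p = mul_y 1.
  by apply/funext => n; apply/esym; exact: (iter_mul_y1 1 n).
rewrite -[LHS]mul_yM; congr mul_y; exact: skew_mul1.
Qed.

Lemma skew_monomial b k j :
  (skew_const b * skew_y p ^+ k) j = if j == k then b else 0.
Proof.
have -> : skew_y p ^+ k = iter k (@mul_y p) 1.
  by elim: k => // k IHk; rewrite exprS IHk skew_yM.
by rewrite [LHS]skew_mul_constl iter_mul_y1; case: eqP; rewrite (mulr1, mulr0).
Qed.

Lemma skew_commutation b :
  skew_y p * skew_const b = skew_const b * skew_y p + skew_const (delta b).
Proof.
rewrite skew_yM; apply/funext => j.
rewrite skewDE -[skew_y p]expr1 skew_monomial /skew_const /mul_y.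
by case: j => [|[|j]] //=; rewrite ?delta0 ?addr0.
Qed.

Lemma skew_y_x :
  let x := skew_const (fps_X (padic p)) in
  skew_y p * x - x * skew_y p = (p ^ 2)%:R.
Proof.
rewrite /= skew_commutation addrAC subrr add0r delta_X.
elim: (p ^ 2)%N => [|n IHn]; first by apply/funext => -[].
rewrite -natr1 -[RHS]natr1 -IHn.
by apply/funext => -[|j] //=; rewrite skewDE addr0.
Qed.

Lemma residue_le (x : padic p) n N : (n <= N)%N ->
  x n = (x N %% (p ^ n)%:Z)%Z.
Proof.
move=> /subnKC <-; elim: (N - n)%N => [|k IHk].
  by rewrite addn0 residue_mod.
rewrite IHk addnS [x (n + k)%N]residueP.
rewrite [in RHS](divz_eq (x (n + k).+1) (p ^ (n + k))%:Z).
set q := (_ %/ _)%Z; set r := (_ %% (p ^ (n + k))%:Z)%Z.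
by rewrite addnC expnD PoszM mulrA modzMDl.
Qed.

Lemma residue_le0 (x : padic p) n N : (n <= N)%N -> x N = 0 -> x n = 0.
Proof. by move=> nN xN0; rewrite (residue_le x nN) xN0 mod0z. Qed.

Lemma residueM0 (x z : padic p) n k N :
  (N <= n + k)%N -> x n = 0 -> z k = 0 -> (x * z) N = 0.
Proof.
move=> Nnk xn zk; apply: residue_le0 Nnk _; rewrite residueM.
move: xn; rewrite (residue_le x (leq_addr k n)) => xn.
move: zk; rewrite (residue_le z (leq_addl n k)) => zk.
rewrite (divz_eq (x (n + k)%N) (p ^ n)%:Z) xn addr0.
rewrite (divz_eq (z (n + k)%N) (p ^ k)%:Z) zk addr0.
by rewrite mulrACA -PoszM -expnD modzMl.
Qed.

Lemma residue_sum0 (I : Type) (r : seq I) (F : I -> padic p) N :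
  (forall e : I, F e N = 0) -> (\sum_(e <- r) F e) N = 0.
Proof.
move=> F0; elim/big_rec: _ => [|i x _ x0]; first exact: residue0.
by rewrite residueD F0 x0 mod0z.
Qed.

(* The k-th power of the ideal (p, x, y): p^(k-i-j) divides the coefficient   *)
(* of x^i y^j. These additive subgroups form a basis of neighbourhoods of 0,  *)
(* and skew_filtrationM makes the multiplication continuous.                  *)
Definition skew_filtration k : set (skewfps p) :=
  [set f | forall i j, f j i (k - i - j)%N = 0].

Lemma skew_filtration_mul_y k f :
  skew_filtration k f -> skew_filtration k.+1 (mul_y f).
Proof.
move=> fk i j; rewrite /mul_y fpsDE residueD.
rewrite [X in X + _](_ : _ = 0) ?add0r.
  suff -> : delta (f j) i (k.+1 - i - j)%N = 0 by rewrite mod0z.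
  apply: (@residue_le0 _ _ (k - i.+1 - j).+2); first lia.
  rewrite /delta fpsMnE -mulnn mulrnA; do 2 apply: residueMp.
  by rewrite /fps_deriv residueMn fk mul0r mod0z.
case: j => [|j]; first exact: residue0.
by have := fk i j; apply: residue_le0; lia.
Qed.

Lemma skew_filtrationM k l f g :
  skew_filtration k f -> skew_filtration l g -> skew_filtration (k + l) (f * g).
Proof.
move=> fk gl i j; rewrite [LHS](skew_mul_cvg _ _ (leqnn _)) fps_sumE.
apply: residue_sum0 => c; rewrite fpsME; apply: residue_sum0 => a.
have gc : skew_filtration (l + c) (iter c (@mul_y p) g).
  elim: (c : nat) => [|d IHd]; first by rewrite addn0.
  by rewrite addnS; exact: skew_filtration_mul_y.
have := gc (i - a)%N j; apply: residueM0 (fk a c).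
by have := ltn_ord a; lia.
Qed.

End SkewRing.

(* Main.v *)
Require Import Defs.
From mathcomp Require Import all_boot all_order all_algebra.
From mathcomp Require Import boolp classical_sets.
From mathcomp Require Import zify.

(** The quotient [R / pR] is [F_p[[x, y]]], a commutative Noetherian domain, and
    [R] is [p]-adically complete with [p] central and regular; being a domain and
    being Noetherian lift along such a reduction, and so do units.  The same
    lifting is used along [F_p[[x]][[y]] -> F_p[[x]] -> F_p].

    If a nonzero prime [P] does not contain [p], then [n f \in P] implies
    [f \in P] for every [n > 0].  Since [[y, f] = p^2 df/dx] and
    [[f, x] = p^2 df/dy], [P] is stable under the divided derivatives in [x] and
    [y].  Take [f \in P] not divisible by [p]; a suitable divided derivative of
    [f] has a unit as constant term, so [P = R], a contradiction. *)

Set Implicit Arguments.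
Unset Strict Implicit.
Unset Printing Implicit Defensive.

Import Order.TTheory GRing.Theory Num.Theory.
Local Open Scope classical_set_scope.
Local Open Scope ring_scope.

(** * Finitely generated left ideals and ascending chains *)

(** Any finite type may index the generators, so that two families are joined by a sum type. *)
Definition left_ideals_fg (S : pzRingType) : Prop :=
  forall I : set S, left_ideal I ->
    exists (J : finType) (g : J -> S), (forall j, I (g j)) /\
      forall a, I a -> exists c : J -> S, a = \sum_j c j * g j.

Section LeftIdeals.
Variable S : pzRingType.
Implicit Type I : set S.

Lemma left_idealB I a b : left_ideal I -> I a -> I b -> I (a - b).
Proof. by case=> I0 ID IM Ia Ib; apply: ID => //; rewrite -mulN1r; apply: IM. Qed.

Lemma left_ideal_sum I (J : finType) (F : J -> S) :
  left_ideal I -> (forall j, I (F j)) -> I (\sum_j F j).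
Proof. by case=> I0 ID _ IF; elim/big_ind: _. Qed.

Lemma ascending_leq (I : nat -> set S) m n :
  ascending I -> (m <= n)%N -> I m `<=` I n.
Proof.
move=> Iasc /subnKC <-; elim: (n - m)%N => [|k IHk]; first by rewrite addn0.
by rewrite addnS => a /IHk /Iasc.
Qed.

(** The union of the chain is a left ideal, and its finitely many generators already lie in one
    term. *)
Lemma left_ideals_fg_noetherian : left_ideals_fg S -> left_noetherian S.
Proof.
move=> fgS I Iid Iasc; pose U : set S := [set a | exists n, I n a].
have Uid : left_ideal U.
  split=> [|a b [m Ia] [n Ib]|r a [n Ia]].
  - by exists 0%N; case: (Iid 0%N).
  - exists (maxn m n); case: (Iid (maxn m n)) => _ + _; apply.
      exact: ascending_leq (leq_maxl _ _) _ Ia.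
    exact: ascending_leq (leq_maxr _ _) _ Ib.
  - by exists n; case: (Iid n) => _ _; apply.
have [J [g [Ug spanU]]] := fgS U Uid.
have [N IgN] := choice Ug.
exists (\max_j N j)%N => m Nm; apply/seteqP; split; last exact: ascending_leq.
move=> a Ia; have [|c ->] := spanU a; first by exists m.
apply: left_ideal_sum => // j; case: (Iid (\max_j N j)%N) => _ _; apply.
exact: ascending_leq (leq_bigmax j) _ (IgN j).
Qed.

End LeftIdeals.

(** * Lifting properties along reduction modulo a central regular element *)

(** This identifies [T] with S/tS, where [S] is separated and complete for the [t]-adic topology;
    completeness is convergence of every series with terms t^k r_k. *)
Record complete_reduction (S T : pzRingType) (phi : S -> T) (t : S) : Prop :=
  CompleteReduction {
    reductionD : {morph phi : a b / a + b};
    reductionM : {morph phi : a b / a * b};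
    reduction1 : phi 1 = 1;
    reduction_surj : forall b, exists a, phi a = b;
    reduction_ker : forall a, phi a = 0 <-> exists b, a = t * b;
    reduction_central : forall a, t * a = a * t;
    reduction_regular : forall a, t * a = 0 -> a = 0;
    reduction_separated : forall a, (forall n, exists b, a = t ^+ n * b) -> a = 0;
    reduction_complete : forall r : nat -> S, exists s, forall n,
      exists b, s = \sum_(k < n) t ^+ k * r k + t ^+ n * b
  }.

Section CompleteReduction.
Variables (S T : pzRingType) (phi : S -> T) (t : S).
Hypothesis red : complete_reduction phi t.

Let phiD := reductionD red.
Let phiM := reductionM red.
Let central := reduction_central red.

Lemma reduction0 : phi 0 = 0.
Proof. by apply: (addrI (phi 0)); rewrite -phiD !addr0. Qed.

Lemma reductionN a : phi (- a) = - phi a.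
Proof. by apply: (addrI (phi a)); rewrite -phiD !subrr reduction0. Qed.

Lemma reductionB a b : phi (a - b) = phi a - phi b.
Proof. by rewrite phiD reductionN. Qed.

Lemma reduction_sum (J : finType) (F : J -> S) :
  phi (\sum_j F j) = \sum_j phi (F j).
Proof. exact: (big_morph _ phiD reduction0). Qed.

Lemma reduction_centralX n a : t ^+ n * a = a * t ^+ n.
Proof.
elim: n => [|n IHn]; rewrite ?mul1r ?mulr1 //.
by rewrite exprS -mulrA IHn mulrA central -mulrA.
Qed.

Lemma reduction_regularX n a : t ^+ n * a = 0 -> a = 0.
Proof.
elim: n => [|n IHn]; first by rewrite mul1r.
by rewrite exprS -mulrA => /(reduction_regular red).
Qed.

(** If division by [t] never stopped, [a] would be divisible by every t^n, hence zero by
    separatedness. *)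
Lemma reduction_primitive a : a <> 0 ->
  exists n b, a = t ^+ n * b /\ phi b <> 0.
Proof.
move=> a0; apply: contrapT => noprim; apply/a0/(reduction_separated red).
elim=> [|n [b ab]]; first by exists a; rewrite mul1r.
have [/(reduction_ker red) [c bc]|phib] := pselect (phi b = 0).
  by exists c; rewrite ab bc mulrA -exprSr.
by case: noprim; exists n, b.
Qed.

(** Powers of [t] are split off both factors until their images in [T] are nonzero; centrality and
    regularity cancel these powers from the product. *)
Lemma reduction_domain : domain T -> domain S.
Proof.
case=> T10 Tdom; split=> [S10|a b ab0].
  by apply: T10; rewrite -(reduction1 red) S10 reduction0.
have [->|/reduction_primitive [m [a' [aE a'0]]]] := pselect (a = 0); first by left.
have [->|/reduction_primitive [n [b' [bE b'0]]]] := pselect (b = 0); first by right.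
have : a' * b' = 0.
  apply/(reduction_regularX (n := m))/(reduction_regularX (n := n)).
  by rewrite -ab0 aE bE [t ^+ m * _]mulrA reduction_centralX -mulrA -reduction_centralX.
by move/(congr1 phi); rewrite phiM reduction0 => /Tdom[].
Qed.

(* The inverse of [1 - t b] is the geometric series in [t b]. *)
Lemma reduction_left_inverse u :
  (exists v, v * phi u = 1) -> exists v, v * u = 1.
Proof.
case=> v'; have [v <-] := reduction_surj red v'; rewrite -phiM => vu1.
have /(reduction_ker red) [b bE] : phi (1 - v * u) = 0.
  by rewrite reductionB (reduction1 red) vu1 subrr.
have [s sP] := reduction_complete red (fun k => b ^+ k).
exists (s * v); apply/eqP; rewrite -subr_eq0; apply/eqP/(reduction_separated red) => n.
have [c ->] := sP n.
have geom : (\sum_(k < n) t ^+ k * b ^+ k) * (v * u) = 1 - t ^+ n * b ^+ n.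
  have -> : v * u = 1 - t * b by rewrite -bE subKr.
  elim: n {c} => [|n IHn]; first by rewrite big_ord0 mul0r mul1r subrr.
  rewrite big_ord_recr /= mulrDl IHn mulrBr mulr1 addrA subrK.
  by congr (_ - _); rewrite -mulrA [b ^+ n * _]mulrA -central -mulrA -exprSr mulrA -exprSr.
exists (c * (v * u) - b ^+ n).
rewrite -mulrA mulrDl geom mulrBr !mulrA.
by rewrite addrAC [1 - _ - 1]addrAC subrr add0r addrC.
Qed.

(* Hilbert's basis argument: [L k] is the ideal of leading coefficients of the
   elements of [I] divisible by [t ^+ k]. *)
Lemma reduction_left_ideals_fg : left_ideals_fg T -> left_ideals_fg S.
Proof.
move=> fgT I Iid; have [I0 ID IM] := Iid.
pose L k : set T := [set b | exists2 a, phi a = b & I (t ^+ k * a)].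
have Lid k : left_ideal (L k).
  split=> [|_ _ [a <- Ia] [b <- Ib]|r _ [a <- Ia]].
  - by exists 0; rewrite ?reduction0 ?mulr0.
  - by exists (a + b); rewrite ?phiD // mulrDr; apply: ID.
  - have [r' <-] := reduction_surj red r; exists (r' * a); rewrite ?phiM //.
    by rewrite mulrA reduction_centralX -mulrA; apply: IM.
have Lasc : ascending L.
  by move=> k _ [a <- Ia]; exists a => //; rewrite exprS -mulrA; apply: IM.
have [K LK] := left_ideals_fg_noetherian fgT Lid Lasc.
(* [D k] is the part of [I] inside t^k S; the aim is to span [D 0]. *)
pose D k a := I a /\ exists b, a = t ^+ k * b.
(* Lifts [h] of generators of [L k] serve every level l >= k with [L l = L k]: subtracting a
   combination of the t^l h_j pushes an element of [D l] into [D l.+1]. *)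
have basis k : exists (J : finType) (h : J -> S),
    (forall j, I (t ^+ k * h j)) /\ forall l, (k <= l)%N -> L l = L k ->
    forall a, D l a -> exists c, D l.+1 (a - \sum_j c j * (t ^+ l * h j)).
  have [J [g [Lg spang]]] := fgT _ (Lid k).
  have /choice [h hP] : forall j, exists a, phi a = g j /\ I (t ^+ k * a).
    by move=> j; have [a ga Ia] := Lg j; exists a.
  exists J, h; split=> [j|l kl Llk a [Ia [b aE]]]; first by case: (hP j).
  have [|c' bE] := spang (phi b); first by rewrite -Llk; exists b; rewrite // -aE.
  have [c cE] := choice (fun j => reduction_surj red (c' j)).
  exists c; split.
    apply: left_idealB => //; apply: left_ideal_sum => // j; apply: (IM).
    by rewrite -(subnK kl) exprD -mulrA; apply: (IM); case: (hP j).
  have /(reduction_ker red) [e eE] : phi (b - \sum_j c j * h j) = 0.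
    rewrite reductionB reduction_sum bE; apply/eqP; rewrite subr_eq0; apply/eqP.
    by apply: eq_bigr => j _; rewrite phiM cE; case: (hP j) => ->.
  exists e; rewrite aE exprSr -mulrA -eE mulrBr; congr (_ - _).
  rewrite mulr_sumr; apply: eq_bigr => j _.
  by rewrite mulrA -reduction_centralX -mulrA.
pose spanned k := exists (J : finType) (g : J -> S), (forall j, I (g j)) /\
  forall a, D k a -> exists c : J -> S, a = \sum_j c j * g j.
(* From level [K] on, one family [h] serves all levels, and the corrections at successive levels add
   up to convergent coefficients. *)
have spannedK : spanned K.
  have [J [h [Ih step]]] := basis K.
  have /choice [C CP] : forall ka : nat * S, exists c, D (K + ka.1)%N ka.2 ->
      D (K + ka.1).+1 (ka.2 - \sum_j c j * (t ^+ (K + ka.1) * h j)).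
    (* Outside [D (K + k)] nothing is required, and the coefficients default to zero. *)
    move=> [k a] /=; have [Da|] := pselect (D (K + k)%N a); last by exists (fun=> 0).
    have [|||c] := step (K + k)%N _ _ a; rewrite ?leq_addr ?LK ?leq_addr //.
    by exists c.
  exists J, (fun j => t ^+ K * h j); split=> // a Da.
  (* [a_ k] is what remains of [a] after [k] corrections. *)
  pose a_ := fix a_ k := if k is k'.+1 then
    a_ k' - \sum_j C (k', a_ k') j * (t ^+ (K + k') * h j) else a.
  have Da_ k : D (K + k)%N (a_ k).
    elim: k => [|k IHk]; first by rewrite addn0.
    by rewrite addnS; exact: CP (k, a_ k) IHk.
  have /choice [s sP] : forall j, exists s, forall n,
      exists b, s = \sum_(k < n) t ^+ k * C (k : nat, a_ k) j + t ^+ n * b.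
    by move=> j; exact: (reduction_complete red (fun k => C (k, a_ k) j)).
  exists s; apply/eqP; rewrite -subr_eq0; apply/eqP/(reduction_separated red) => n.
  have /choice [b bP] := fun j => sP j n.
  have [_ [e eE]] := Da_ n.
  (* The remainder t^(K+n) e minus the tails t^n b_j t^K h_j, divided by t^n. *)
  exists (t ^+ K * e - \sum_j b j * (t ^+ K * h j)).
  rewrite mulrBr mulrA -exprD addnC -eE mulr_sumr.
  have aE m : a = a_ m +
      \sum_j (\sum_(k < m) t ^+ k * C (k : nat, a_ k) j) * (t ^+ K * h j).
    elim: m => [|m {1}->] /=.
      by rewrite big1 ?addr0 // => j _; rewrite big_ord0 mul0r.
    rewrite -addrA; congr (_ + _); apply: (addrI (\sum_j C (m, a_ m) j * (t ^+ (K + m) * h j))).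
    rewrite addNKr -big_split; apply: eq_bigr => j _ /=.
    rewrite big_ord_recr mulrDl addrC; congr (_ + _) => /=.
    by rewrite addnC exprD (reduction_centralX m (C _ _)) -!mulrA.
  rewrite {1}(aE n) -addrA; congr (_ + _); rewrite -sumrB -sumrN.
  apply: eq_bigr => j _; rewrite {1}(bP j) mulrDl opprD addrA subrr add0r.
  by rewrite -!mulrA.
(* Only finitely many levels lie below [K]; each adds its own lifts to the generators. *)
have spannedS k : spanned k.+1 -> spanned k.
  case=> [J1 [g1 [Ig1 span1]]]; have [J2 [h [Ih step]]] := basis k.
  pose g j := match j with inl j => g1 j | inr j => t ^+ k * h j end.
  exists (J1 + J2)%type, g; split=> [[]//|a].
  case/(step k (leqnn k) erefl) => c2 /span1 [c1 aE].
  exists (fun j => match j with inl j => c1 j | inr j => c2 j end).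
  by rewrite big_sumType /= -aE subrK.
have spanned0 : spanned 0%N by elim: (K) spannedK => // k IHk /spannedS.
have [J [g [Ig spang]]] := spanned0; exists J, g; split=> // a Ia.
by apply: spang; split=> //; exists a; rewrite mul1r.
Qed.

End CompleteReduction.

(** * Power series over a commutative ring *)

Section FpsReduction.
Variable A : comPzRingType.
Implicit Types (f g : fps A) (n : nat).

Lemma fps_XM f n : (fps_X A * f) n = if n is m.+1 then f m else 0.
Proof.
rewrite fpsME big_ord_recl {1}/fps_X mul0r add0r.
case: n => [|n]; first by rewrite big_ord0.
rewrite big_ord_recl {1}/fps_X mul1r big1 ?addr0 => [|i _].
  by rewrite subSS subn0.
by rewrite /fps_X mul0r.
Qed.

Lemma fps_XnM k f n :
  (fps_X A ^+ k * f) n = if (k <= n)%N then f (n - k)%N else 0.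
Proof.
elim: k n => [|k IHk] n; first by rewrite mul1r subn0.
by rewrite exprS -mulrA fps_XM; case: n => // n; rewrite IHk.
Qed.

Lemma fps_coef0_reduction :
  complete_reduction (fun f : fps A => f 0%N) (fps_X A).
Proof.
split=> [f g|f g||b|f|f|f|f f0|r] //.
- by rewrite fpsME big_ord_recl big_ord0 addr0.
- by exists (fps_const b).
- split=> [f0|[g ->]]; last exact: fps_XM.
  by exists (fun n => f n.+1); apply/funext=> -[|n]; rewrite fps_XM.
- exact: mulrC.
- by move=> Xf0; apply/funext=> n; rewrite -(fps_XM f n.+1) Xf0.
- apply/funext=> n; have [g ->] := f0 n.+1.
  by rewrite fps_XnM ltnn.
(* The sum of the X^k r_k: only the terms with k <= n reach the coefficient of X^n. *)
pose s : fps A := fun n => \sum_(k < n.+1) r k (n - k)%N.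
exists s => n.
(* The remainder has no coefficient below X^n, so its quotient by X^n is a shift. *)
exists (fun m => (s - \sum_(k < n) fps_X A ^+ k * r k) (n + m)%N).
apply/funext => i; rewrite fpsDE fps_XnM; case: leqP => [ni|in_].
  by rewrite subnKC // -fpsDE addrC subrK.
rewrite addr0 fps_sumE /s (big_ord_widen n (fun k => r k (i - k)%N)) // big_mkcond.
by apply: eq_bigr => k _; rewrite fps_XnM ltnS.
Qed.

End FpsReduction.

Section FpsMap.
Variables (A B : comPzRingType) (phi : A -> B).
Hypothesis phiD : {morph phi : a b / a + b}.
Hypothesis phiM : {morph phi : a b / a * b}.

Definition fps_map (f : fps A) : fps B := fun n => phi (f n).

Lemma fps_mapD : {morph fps_map : f g / f + g}.
Proof. by move=> f g; apply/funext=> n; exact: phiD. Qed.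

Lemma fps_mapM : {morph fps_map : f g / f * g}.
Proof.
have phi0 : phi 0 = 0 by apply: (addrI (phi 0)); rewrite -phiD !addr0.
move=> f g; apply/funext=> n; rewrite /fps_map !fpsME (big_morph _ phiD phi0).
by apply: eq_bigr => i _; rewrite phiM.
Qed.

End FpsMap.

(** * Divisibility by p and reduction modulo p in Z_p *)

Section Padic.
Variable p : nat.
Hypothesis p_pr : prime p.
Implicit Types a b : padic p.

Let pX_gt0 n : (0 < (p ^ n)%:Z)%R.
Proof. by rewrite ltz_nat expn_gt0 prime_gt0. Qed.

Lemma residue_mulpX b n : (b *+ p ^ n) n = 0.
Proof. by rewrite residueMn modzMl. Qed.

(** Division by p^n loses n digits: the quotient modulo p^k is read off [a] modulo p^(n+k). *)
Lemma residue_eq0_dvd a n : a n = 0 -> exists b, a = b *+ p ^ n.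
Proof.
move=> an0; have aE k : a (n + k)%N = ((a (n + k)%N %/ (p ^ n)%:Z)%Z * (p ^ n)%:Z)%R.
  have := residue_le a (leq_addr k n); rewrite an0.
  by rewrite {2}[a (n + k)%N](divz_eq _ (p ^ n)%:Z) => <-; rewrite addr0.
pose u k := (a (n + k)%N %/ (p ^ n)%:Z)%Z.
have uP k : u k = (u k.+1 %% (p ^ k)%:Z)%Z.
  rewrite {1}/u residueP -addnS aE -/(u _) expnD PoszM [_ * (p ^ n)%:Z]mulrC.
  by rewrite -mulz_modr // mulrC mulzK // gt_eqF.
exists (Padic uP); apply/padicP=> k.
by rewrite residueMn [Padic uP k]/u -aE -(residue_le a (leq_addl n k)).
Qed.

(** If p a vanishes modulo p^(n+1), then a vanishes modulo p^n. *)
Lemma padic_mulp_eq0 a : a *+ p = 0 -> a = 0.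
Proof.
move=> ap0; apply/padicP=> n; rewrite residue0 residueP.
apply: (@mulfI _ (p%:Z)); first by rewrite gt_eqF // (pX_gt0 1).
rewrite mulr0 mulz_modr ?(pX_gt0 1) // mulrC -PoszM -expnS.
by rewrite -residueMn ap0 residue0.
Qed.

(** Level 1 is the residue modulo p; level 0 is the residue modulo p^0 = 1. *)
Definition padic_red a : 'F_p := (a 1%N)%:~R.

Lemma intr_Fp_mod (x : int) : ((x %% p%:Z)%Z%:~R : 'F_p) = x%:~R.
Proof.
by rewrite [in RHS](divz_eq x p%:Z) [RHS]intrD intrM -[p%:Z%:~R]pmulrn pchar_Fp_0 // mulr0 add0r.
Qed.

Lemma padic_redD : {morph padic_red : a b / a + b}.
Proof. by move=> a b; rewrite /padic_red residueD expn1 intr_Fp_mod intrD. Qed.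

Lemma padic_redM : {morph padic_red : a b / a * b}.
Proof. by move=> a b; rewrite /padic_red residueM expn1 intr_Fp_mod intrM. Qed.

Lemma padic_red_nat n : padic_red n%:R = n%:R.
Proof.
rewrite /padic_red residueMn -[(1 : padic p) 1%N]/(1 %% (p ^ 1)%:Z)%Z expn1.
by rewrite intr_Fp_mod intrM intr_Fp_mod mul1r.
Qed.

Lemma padic_red_eq0 a : padic_red a = 0 <-> a 1%N = 0.
Proof.
rewrite /padic_red; split=> [|->//].
have := residue_mod a 1; rewrite expn1.
have p0 := prime_gt0 p_pr.
have a0 : (0 <= a 1%N)%R by rewrite -(residue_mod a 1) modz_ge0 // gt_eqF.
have ap : (a 1%N < p%:Z)%R by rewrite -[a 1%N](residue_mod a 1) expn1 ltz_pmod.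
case: (a 1%N) a0 ap => // m _; rewrite ltz_nat => mp _ /eqP.
rewrite -pmulrn -(dvdn_pcharf (pchar_Fp p_pr)) => /dvdnP[[|k] mE]; lia.
Qed.

End Padic.

(** * The reduction of R modulo p *)

Section SkewReduction.
Variable p : nat.
Hypothesis p_pr : prime p.
Local Notation B := (fps (padic p)).
Implicit Types (f g : skewfps p) (n : nat).

(** Index [j] is the exponent of y and [i] that of x. The target can be the commutative ring of
    series because delta is divisible by p. *)
Definition skew_red f : fps (fps 'F_p) := fun j i => padic_red (f j i).

Let redB : B -> fps 'F_p := fps_map (@padic_red p).
Let redBD : {morph redB : b c / b + c} := fps_mapD (padic_redD p_pr).
Let redBM : {morph redB : b c / b * c} :=
  fps_mapM (padic_redD p_pr) (padic_redM p_pr).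

Let redB0 : redB 0 = 0.
Proof. by apply: (addrI (redB 0)); rewrite -redBD !addr0. Qed.

Lemma eqmod1_red (b c : B) : eqmod 1 b c -> redB b = redB c.
Proof. by move=> bc; apply/funext=> i; rewrite /redB /fps_map /padic_red bc. Qed.

Lemma red_delta (b : B) : redB (delta b) = 0.
Proof.
rewrite -redB0; apply: eqmod1_red; apply: eqmod_delta0 => i.
by rewrite !residue_level0.
Qed.

(** Since delta vanishes modulo p, left multiplication by y is there a mere shift. *)
Lemma red_iter_mul_y k g j :
  redB (iter k (@mul_y p) g j) = if (k <= j)%N then redB (g (j - k)%N) else 0.
Proof.
elim: k j => [|k IHk] j; first by rewrite subn0.
rewrite iterS; case: j => [|j]; first by rewrite mul_y0 red_delta.
by rewrite mul_yS redBD red_delta addr0 IHk.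
Qed.

Lemma skew_redM : {morph skew_red : f g / f * g}.
Proof.
move=> f g; apply/funext=> j; rewrite fpsME.
(* At precision 1 the terms with k < j + 1 suffice, which is the range of the Cauchy product. *)
have := skew_mul_cvg f g (leqnn (j + 1)); rewrite addn1 => /eqmod1_red.
rewrite (big_morph _ redBD redB0) => E; rewrite [LHS]E.
by apply: eq_bigr => k _; rewrite redBM red_iter_mul_y -ltnS ltn_ord.
Qed.

Lemma skewMnE f n j i : (f *+ n) j i = f j i *+ n.
Proof. by elim: n => // n IHn; rewrite !mulrS -IHn. Qed.

Lemma skew_pXM n f j i : ((p%:R : skewfps p) ^+ n * f) j i = f j i *+ p ^ n.
Proof. by rewrite -natrX mulr_natl skewMnE. Qed.

Lemma skew_dvdpX n f : (forall j i, f j i n = 0) ->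
  exists g, f = p%:R ^+ n * g.
Proof.
move=> f0.
have /choice [g gP] : forall ji : nat * nat, exists b, f ji.1 ji.2 = b *+ p ^ n.
  by move=> [j i]; apply: residue_eq0_dvd.
exists (fun j i => g (j, i)); apply/funext=> j; apply/funext=> i.
by rewrite skew_pXM (gP (j, i)).
Qed.

Lemma skew_reduction : complete_reduction skew_red (p%:R : skewfps p).
Proof.
have sumE (r : nat -> skewfps p) n j i : (\sum_(k < n) p%:R ^+ k * r k) j i =
    \sum_(k < n) r k j i *+ p ^ k.
  elim: n => [|n IHn]; first by rewrite !big_ord0.
  by rewrite !big_ord_recr /= -IHn -skew_pXM.
split=> [f g|||b|f|f|f pf0|f f0|r].
- by apply/funext=> j; exact: redBD.
- exact: skew_redM.
- apply/funext=> -[|j]; apply/funext=> -[|i]; rewrite /skew_red /=.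
  + exact: (padic_red_nat p_pr 1).
  + exact: (padic_red_nat p_pr 0).
  + exact: (padic_red_nat p_pr 0).
  + exact: (padic_red_nat p_pr 0).
(* Each coefficient in F_p is lifted to its natural representative. *)
- exists (fun j i => (val (b j i))%:R); apply/funext=> j; apply/funext=> i.
  by rewrite /skew_red padic_red_nat // natr_Zp.
- split=> [f0|[g ->]]; last first.
    apply/funext=> j; apply/funext=> i; apply/padic_red_eq0 => //.
    by rewrite -[p%:R]expr1 skew_pXM residue_mulpX.
  have [|g fg] := @skew_dvdpX 1 f; last by exists g.
  by move=> j i; apply/padic_red_eq0 => //; rewrite -[LHS]/(skew_red f j i) f0.
- by rewrite (commr_nat f p).
- apply/funext=> j; apply/funext=> i; apply: padic_mulp_eq0 => //.
  by rewrite -[in p in _ *+ p](expn1 p) -skew_pXM expr1 pf0.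
- apply/funext=> j; apply/funext=> i; apply/padicP=> n; have [g ->] := f0 n.
  by rewrite skew_pXM residue_mulpX residue0.
(* [v m] is the m-th partial sum. The limit [s] is diagonal: its level n is taken from [v n], as the
   later terms are divisible by p^n. *)
pose v m j i := \sum_(k < m) r k j i *+ p ^ k.
have vS n j i : v n j i n = (v n.+1 j i n.+1 %% (p ^ n)%:Z)%Z.
  rewrite -residueP {2}/v big_ord_recr /= residueD residue_mulpX addr0.
  by rewrite residue_mod.
pose s : skewfps p := fun j i => Padic (fun n => vS n j i).
exists s => n; have [|g gE] := @skew_dvdpX n (s - \sum_(k < n) p%:R ^+ k * r k).
  move=> j i; transitivity ((s j i - (\sum_(k < n) p%:R ^+ k * r k) j i) n) => //.
  by rewrite sumE residueD modzDmr [s j i n]/(v n j i n) subrr mod0z.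
by exists g; rewrite -gE addrC subrK.
Qed.

End SkewReduction.

(** * Opposite rings, fields and generalities on prime ideals *)

(** Commutativity of [T] keeps [phi] multiplicative on the opposite ring. Right ideals of [S] are
    left ideals of [S^c], so this yields the right Noetherian property. *)
Lemma complete_reduction_converse (S : pzRingType) (T : comPzRingType)
    (phi : S -> T) (t : S) :
  complete_reduction phi t -> @complete_reduction S^c T phi t.
Proof.
move=> red; have [phiD phiM phi1 surj ker central regular sep compl] := red.
have tX n : (t : S^c) ^+ n = t ^+ n.
  by elim: n => // n IHn; rewrite exprS exprSr IHn.
have tXM n a : (t : S^c) ^+ n * a = t ^+ n * a :> S.
  by rewrite tX (reduction_centralX red).
split=> // [a b|a|a|a ta0|a a0|r].
- by rewrite mulrC -phiM.
- by split=> [/ker [b ->]|[b ->]]; [exists b | apply/ker; exists b]; rewrite (central b).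
- by apply/esym/central.
- by apply: regular; rewrite central.
- by apply: sep => n; have [b ->] := a0 n; exists b; rewrite tXM.
have [s sP] := compl r; exists s => n; have [b ->] := sP n; exists b.
by rewrite tXM; congr (_ + _); apply: eq_bigr => k _; rewrite tXM.
Qed.

Lemma field_left_ideals_fg (F : fieldType) : left_ideals_fg F.
Proof.
move=> I Iid; have [I0 ID IM] := Iid.
have [a [Ia aP]] : exists a, I a /\ forall b, I b -> exists c, b = c * a.
  have [[a [Ia a0]]|noI] := pselect (exists a, I a /\ a <> 0).
    by exists a; split=> // b _; exists (b / a); rewrite divfK //; apply/eqP.
  exists 0; split=> // b Ib; exists 0; rewrite mulr0; apply: contrapT => b0.
  by apply: noI; exists b.
exists unit, (fun=> a); split=> // b /aP [c ->]; exists (fun=> c).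
by rewrite big_const card_unit /= addr0.
Qed.

Lemma idomain_domain (F : idomainType) : domain F.
Proof.
split=> [|a b /eqP]; first exact/eqP/oner_neq0.
by rewrite mulf_eq0 => /orP[]/eqP; [left | right].
Qed.

Lemma quotient_domain_prime (S : pzRingType) (P : set S) :
  two_sided_ideal P -> quotient_domain P -> prime_ideal P.
Proof.
move=> Pid [P1 PM]; split=> // [PT|I J _ _ IJ]; first by apply: P1; rewrite PT.
have [IP|/existsNP [a /not_implyP [Ia Pa]]] := pselect (I `<=` P); [by left|right].
by move=> b Jb; have [] := PM _ _ (IJ _ _ Ia Jb).
Qed.

Lemma principal_right_ideal (S : pzRingType) (q : S) :
  (forall a, q * a = a * q) -> two_sided_ideal (principal_right q).
Proof.
have I0 : principal_right q 0 by exists 0; rewrite ?mulr0.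
have ID a b : principal_right q a -> principal_right q b -> principal_right q (a + b).
  by move=> [a' _ <-] [b' _ <-]; exists (a' + b'); rewrite ?mulrDr.
move=> qC; split; split=> // r _ [a _ <-].
  by exists (r * a); rewrite // mulrA qC mulrA.
by exists (a * r); rewrite // mulrA.
Qed.

(** Primeness is applied to qS and to the set of b with q b in [P], both two-sided ideals because
    [q] is central. *)
Lemma prime_ideal_central (S : pzRingType) (P : set S) (q a : S) :
  prime_ideal P -> (forall b, q * b = b * q) -> P (q * a) -> P q \/ P a.
Proof.
move=> [[[P0 PD PMl] [_ _ PMr]] _ Pprime] qC Pqa.
pose J : set S := [set b | P (q * b)].
have Jid : two_sided_ideal J.
  have J0 : J 0 by rewrite /J /= mulr0.
  have JD b c : J b -> J c -> J (b + c) by rewrite /J /= mulrDr; exact: PD.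
  split; split=> // r b Jb; rewrite /J /= mulrA; last exact: PMr.
  by rewrite qC -mulrA; exact: PMl.
have [|qP|JP] := Pprime _ _ (principal_right_ideal qC) Jid.
- by move=> _ b [c _ <-] Jb; rewrite qC -mulrA; exact: PMl.
- by left; apply: qP; exists 1; rewrite ?mulr1.
- by right; apply: JP.
Qed.

(** * Divided derivatives *)

Section DividedDerivative.
Variable A : zmodType.
Implicit Types f : fps A.

(** This is the i-th derivative over i!, written without division. Coefficients in any additive
    group allow its use both in x and in y. *)
Definition fps_dderiv i f : fps A := fun n => f (n + i)%N *+ 'C(n + i, i).

Lemma fps_dderiv0 f : fps_dderiv 0 f = f.
Proof. by apply/funext=> n; rewrite /fps_dderiv addn0 bin0. Qed.

(** The induction on i rests on this recursion; the factor i + 1 is later cancelled modulo a prime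
    not containing p. *)
Lemma fps_deriv_dderiv i f : fps_deriv (fps_dderiv i f) = fps_dderiv i.+1 f *+ i.+1.
Proof.
apply/funext=> n; rewrite fpsMnE /fps_deriv /fps_dderiv -!mulrnA addSnnS.
congr (_ *+ _); rewrite [RHS]mulnC mul_bin_left mulnC.
by rewrite addnS -addSn addnK.
Qed.

End DividedDerivative.

(** * Ring structure of R and commutators with x and y *)

Section SkewPrimes.
Variable p : nat.
Hypothesis p_pr : prime p.
Local Notation R := (skewfps p).
Local Notation x := (skew_const (fps_X (padic p))).
Local Notation y := (skew_y p).
Implicit Types f g : R.

Let red := skew_reduction p_pr.
Let red_xy := fps_coef0_reduction (fps 'F_p).
Let red_x := fps_coef0_reduction 'F_p.

Lemma skewfps_noetherian : noetherian R.
Proof.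
have fg := reduction_left_ideals_fg red_xy
  (reduction_left_ideals_fg red_x (@field_left_ideals_fg _)).
split; first exact/left_ideals_fg_noetherian/(reduction_left_ideals_fg red fg).
exact: left_ideals_fg_noetherian
  (reduction_left_ideals_fg (complete_reduction_converse red) fg).
Qed.

Lemma skewfps_domain : domain R.
Proof.
apply/(reduction_domain red)/(reduction_domain red_xy)/(reduction_domain red_x).
exact: idomain_domain.
Qed.

Lemma skewfps_unit f : padic_red (f 0%N 0%N) <> 0 -> exists g, g * f = 1.
Proof.
move=> /eqP f0; apply/(reduction_left_inverse red)/(reduction_left_inverse red_xy).
apply/(reduction_left_inverse red_x); exists (padic_red (f 0%N 0%N))^-1.
exact: mulVf.
Qed.

(** Coefficients stand to the left of the powers of y, so right multiplication by y only shifts. *)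
Lemma skew_My f j : (f * y) j = if j is k.+1 then f k else 0.
Proof.
have yE : y = iter 1 (@mul_y p) (skew_const 1).
  by apply/funext=> k; rewrite iter_mul_y1.
have iterE k i : iter k (@mul_y p) y i = (i == k.+1)%:R.
  by rewrite yE -iterD addn1 iter_mul_y1.
suff -> : f * y = (fun j => if j is k.+1 then f k else 0) by [].
apply: Defs.eqmodP => N {}j; apply: eqmod_trans (skew_mul_cvg _ _ (leqnn _)) _.
under eq_bigr do rewrite iterE.
case: j => [|j]; first by rewrite big1 // => k _; rewrite mulr0.
have jm : (j < j.+1 + N)%N by lia.
rewrite (bigD1 (Ordinal jm)) //= eqxx mulr1 big1 ?addr0 // => k.
by rewrite -val_eqE /= eqSS eq_sym => /negPf->; rewrite mulr0.
Qed.

(** The shift inside [mul_y] cancels against f y and leaves delta acting on the coefficients. *)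
Lemma skew_commutator_y f :
  y * f - f * y = (p ^ 2)%:R * ((fun j => fps_deriv (f j)) : R).
Proof.
rewrite mulr_natl skew_yM; apply/funext=> j; apply/funext=> i.
rewrite skewMnE -fpsMnE -/(delta (f j)).
transitivity ((mul_y f j - (f * y) j) i) => //.
by rewrite skew_My /mul_y addrC addKr.
Qed.

(** This is y^k x = x y^k + p^2 k y^(k-1); the test [j.+1 == k] avoids a predecessor at k = 0. *)
Lemma iter_mul_y_x k j : iter k (@mul_y p) x j =
  fps_X (padic p) *+ (j == k) + (p ^ 2 * k)%:R *+ (j.+1 == k).
Proof.
elim: k j => [|k IHk] j.
  by rewrite /= /skew_const addr0; case: eqP.
rewrite iterS /mul_y IHk deltaD.
have -> : delta (fps_X (padic p) *+ (j == k)) = (p ^ 2)%:R *+ (j == k).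
  by case: (j == k); rewrite ?delta0 ?delta_X.
have -> : delta ((p ^ 2 * k)%:R *+ (j.+1 == k)) = 0 :> fps (padic p).
  by case: (_ == k); rewrite ?delta0 // mulr1n delta_nat.
rewrite addr0 eqSS mulnS natrD mulrnDl.
case: j => [|j]; last by rewrite IHk eqSS -addrA [X in _ + X]addrC.
by case: k {IHk} => [|k]; rewrite /= ?muln0 ?addr0 ?add0r.
Qed.

(** Here [fps_deriv f] is the derivative in y, since the outer index of [f] is the exponent of y. *)
Lemma skew_commutator_x f : f * x - x * f = (p ^ 2)%:R * (fps_deriv f : R).
Proof.
suff fxE : f * x = x * f + (fps_deriv f : R) *+ p ^ 2.
  by rewrite fxE addrC addKr mulr_natl.
(* Two extra terms keep the contributing indices k = j and k = j + 1 in range even for N = 0. *)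
apply: Defs.eqmodP => N j; apply: eqmod_trans (skew_mul_cvg _ _ (leq_addr 2 _)) _.
under eq_bigr do rewrite iter_mul_y_x mulrDr.
have jm : (j < j + N + 2)%N by lia.
have j1m : (j.+1 < j + N + 2)%N by lia.
rewrite big_split /= (bigD1 (Ordinal jm)) //= eqxx mulr1n big1 ?addr0; last first.
  by move=> k; rewrite -val_eqE /= eq_sym => /negPf->; rewrite mulr0.
rewrite (bigD1 (Ordinal j1m)) //= eqxx mulr1n big1 ?addr0; last first.
  by move=> k; rewrite -val_eqE /= eq_sym => /negPf->; rewrite mulr0.
move=> i; congr (residue (_ i) N); rewrite skewDE.
rewrite [(x * f) j]skew_mul_constl mulrC;
suff -> : f j.+1 * (p ^ 2 * j.+1)%:R = (fps_deriv f *+ p ^ 2) j :> fps (padic p) by [].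
apply/funext=> {}i; rewrite skewMnE mulr_natr fpsMnE /fps_deriv.
by rewrite fpsMnE -mulrnA mulnC.
Qed.

(** * Prime ideals not containing p *)

Section PrimeWithoutP.
Variable P : set R.
Hypotheses (Pprime : prime_ideal P) (Pp : ~ P p%:R).

Let natC n g : n%:R * g = g * n%:R.
Proof. by rewrite (commr_nat g n). Qed.

(** Factors p of n are cancelled one at a time, p being central and outside [P]; an n prime to p is
    invertible in R. *)
Lemma prime_saturated n f : (0 < n)%N -> P (n%:R * f) -> P f.
Proof.
have [[[P0 PD PMl] [_ _ PMr]] _ _] := Pprime.
elim/ltn_ind: n => n IHn n0.
have [/dvdnP [m nE]|pn] := boolP (p %| n)%N.
  rewrite nE natrM -mulrA => Pf.
  have m0 : (0 < m)%N by move: n0; rewrite nE muln_gt0 => /andP[].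
  apply: (IHn m) => //; first by rewrite nE ltn_Pmulr ?prime_gt1.
  move: Pf; rewrite mulrA -natrM mulnC natrM -mulrA.
  by case/(prime_ideal_central Pprime (natC p)).
have [|g gn] := @skewfps_unit (n%:R : R).
  have -> : (n%:R : R) 0%N 0%N = n%:R.
    rewrite -[n%:R]/(1 *+ n) skewMnE; congr (_ *+ n).
  rewrite padic_red_nat //; apply/eqP.
  by rewrite -(dvdn_pcharf (pchar_Fp p_pr)).
by move=> Pnf; rewrite -[f]mul1r -gn -mulrA; apply: PMl.
Qed.

Lemma prime_commutator f g h :
  P f -> g * f - f * g = (p ^ 2)%:R * h -> P h.
Proof.
have [[[P0 PD PMl] [_ _ PMr]] _ _] := Pprime.
move=> Pf gfE; apply: (@prime_saturated (p ^ 2)).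
  by rewrite expn_gt0 prime_gt0.
by rewrite -gfE; apply: PD; [apply: PMl | rewrite -mulrN; apply: PMr].
Qed.

(** By induction: p^2 (i + 1) times the next divided derivative is a commutator with y, and
    saturation cancels both factors. *)
Lemma prime_dderiv_x i f : P f -> P (fun j => fps_dderiv i (f j)).
Proof.
move=> Pf; elim: i => [|i IHi].
  by under eq_fun do rewrite fps_dderiv0.
apply: (@prime_saturated i.+1) => //.
have := prime_commutator IHi (skew_commutator_y _); congr P.
apply/funext=> j; rewrite fps_deriv_dderiv mulr_natl; apply/funext=> k.
by rewrite skewMnE fpsMnE.
Qed.

Lemma prime_dderiv_y i f : P f -> P (fps_dderiv i f).
Proof.
move=> Pf; elim: i => [|i IHi]; first by rewrite fps_dderiv0.
apply: (@prime_saturated i.+1) => //; rewrite mulr_natl -fps_deriv_dderiv.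
have [[_ [_ _ PMr]] _ _] := Pprime.
(* The sign reverses the order of the commutator, since [skew_commutator_x] is about f x - x f. *)
apply: (@prime_commutator (- (fps_dderiv i f : R)) x).
  by rewrite -[- _]mulrN1; apply: PMr.
by rewrite mulrN mulNr opprK addrC skew_commutator_x.
Qed.

End PrimeWithoutP.

(* After dividing [f] by a power of [p], some coefficient [f j i] is a unit, and
   the divided derivative of bidegree [(i, j)] makes it the constant term. *)
Lemma nonzero_prime_p (P : set R) : prime_ideal P -> P <> [set 0] -> P p%:R.
Proof.
move=> Pprime P_neq0; have [[[P0 PD PMl] _] PT _] := Pprime.
have [f [Pf f0]] : exists f, P f /\ f <> 0.
  apply: contrapT => noP; apply: P_neq0; apply/seteqP; split=> [f Pf|_ ->//].
  by apply: contrapT => f0; apply: noP; exists f.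
apply: contrapT => Pp.
have [n [g [fE g0]]] := reduction_primitive red f0.
have Pg : P g.
  apply: (prime_saturated Pprime Pp (n := p ^ n)); first by rewrite expn_gt0 prime_gt0.
  by rewrite natrX -fE.
have [j [i gji]] : exists j i, padic_red (g j i) <> 0.
  apply: contrapT => noji; apply: g0; apply/funext=> j; apply/funext=> i.
  by apply: contrapT => gji; apply: noji; exists j, i.
have Ph := prime_dderiv_y Pprime Pp j (prime_dderiv_x Pprime Pp i Pg).
have [|v vh] := skewfps_unit (f := fps_dderiv j (fun j => fps_dderiv i (g j))).
  by rewrite /fps_dderiv add0n binn mulr1n add0n binn.
apply: PT; apply/seteqP; split=> // a _.
by rewrite -[a]mulr1 -vh; do 2 apply: (PMl).
Qed.

(** * The ideal pR and the primes of height one *)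

Lemma p_quotient_domain : quotient_domain (principal_right (p%:R : R)).
Proof.
have [xy10 xyM] := reduction_domain red_xy (reduction_domain red_x (idomain_domain _)).
have kerE f : principal_right p%:R f <-> skew_red f = 0.
  split=> [[g _ <-]|/(reduction_ker red) [g ->]]; last by exists g.
  by apply/(reduction_ker red); exists g.
split=> [/kerE|f g /kerE]; rewrite ?(reduction1 red) // (reductionM red).
by case/xyM => ?; [left | right]; apply/kerE.
Qed.

Lemma p_prime : prime_ideal (principal_right (p%:R : R)).
Proof.
apply: quotient_domain_prime p_quotient_domain.
exact/principal_right_ideal/(reduction_central red).
Qed.

Lemma p_neq0 : (p%:R : R) <> 0.
Proof.
move=> p0; have [] := skewfps_domain; case.
by apply: (reduction_regular red); rewrite mulr1.
Qed.

Lemma p_completely_prime : completely_prime (p%:R : R).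
Proof.
split; [exact: p_neq0 | | exact: p_quotient_domain].
by apply/seteqP; split=> _ [f _ <-]; exists f; rewrite // (reduction_central red).
Qed.

(** Every nonzero prime contains p, so pR, itself a nonzero prime, lies below all of them. *)
Lemma height1_prime_p (P : set R) :
  height1_prime P <-> P = principal_right (p%:R : R).
Proof.
have pneq0 : principal_right (p%:R : R) <> [set 0].
  by move=> pE; apply: p_neq0; rewrite -[_ = _]/([set 0] p%:R) -pE; exists 1; rewrite ?mulr1.
have psub Q : prime_ideal Q -> Q <> [set 0] -> principal_right (p%:R : R) `<=` Q.
  move=> Qprime /(nonzero_prime_p Qprime) Qp _ [f _ <-].
  by case: Qprime => [[_ [_ _ QMr]] _ _]; apply: QMr.
split=> [[Pprime P0 Pmin]|->].
  by apply/esym/Pmin => //; [exact: p_prime | exact: psub].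
by split=> // [|Q Qprime Q0 QP]; [exact: p_prime | apply/seteqP; split=> //; exact: psub].
Qed.

Lemma skewfps_noncommutative : noncommutative R.
Proof.
exists y, x => yx; have := skew_y_x p; rewrite /= yx subrr => /esym/eqP.
rewrite natrX => /eqP; rewrite expr2 => pp0.
by apply/p_neq0/(reduction_regular red).
Qed.

End SkewPrimes.

Theorem mainTheorem6 (p : nat) (hp : prime p) :
  (forall P : set (skewfps p),
     height1_prime P <-> P = principal_right (p%:R : skewfps p))
  /\ noncommutative (skewfps p)
  /\ chatters_jordan_UFD (skewfps p).
Proof.
split; first exact: height1_prime_p.
split; first exact: skewfps_noncommutative.
split; [exact: skewfps_noetherian | exact: skewfps_domain | move=> P Pprime P0].
by exists p%:R; [exact: nonzero_prime_p | exact: p_completely_prime].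
Qed.
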